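(* Let $S$ be an $E$-dense semigroup whose set of idempotents $E$ is a semilattice, and let $H$ be a closed $E$-dense subsemigroup of $S$. Then the set $S/H$ of left $\omega$-cosets of $H$ in $S$ is a transitive $E$-dense $S$-act with (partial) action given by $s\cdot X=(sX)\omega$ whenever $X\in S/H$ and $(sX)\omega\in S/H$. Moreover, the stabilizer of the coset $H\omega\ (=H)$ is $S_{H\omega}=H$.
   Context: For a semigroup $S$, $E=E(S)$ is its set of idempotents and $W(s)=\{s'\in S\mid s'ss'=s'\}$ is the set of weak inverses of $s\in S$. $S$ is $E$-dense if for every $s\in S$ there are $t,u\in S$ with $ts\in E$ and $su\in E$ (equivalently $W(s)\neq\emptyset$ for all $s$). $E$ is a semilattice if it is a subsemigroup and its elements commute. Partial order on $S$: $s\le t$ iff $s=t$ or there are $e,f\in E$ with $s=te=ft$. For $A\subseteq S$, $A\omega=\{s\in S\mid a\le s\text{ for some }a\in A\}$, and $A$ is closed if $A=A\omega$. An $E$-dense subsemigroup of $S$ is a (nonempty) subsemigroup $H$ with $W(h)\cap H\ne\emptyset$ for all $h\in H$, where $W(h)$ is computed in $S$. For a closed $E$-dense subsemigroup $H$, let $D_H=\{s\in S\mid \exists s'\in W(s),\ s's\in H\}$. The left $\omega$-cosets of $H$ are the sets $(sH)\omega$ with $s\in D_H$; $S/H$ is the set of all of them. An $E$-dense $S$-act is a nonempty set $X$ with a partial map $S\times X\to X$, $(s,x)\mapsto sx$, such that $(st)x$ exists iff $tx$ and $s(tx)$ exist, and then $(st)x=s(tx)$; which is cancellative (if $sx,sy$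 exist and $sx=sy$ then $x=y$) and reflexive (if $sx$ exists then there is $s'\in W(s)$ such that $s'(sx)$ exists). The stabilizer of $x\in X$ is $S_x=\{s\in S\mid sx\text{ exists and }sx=x\}$. $X$ is transitive if for all $x,y\in X$ there is $s\in S$ such that $sx$ exists and $y=sx$. *)

(* Defs.v *)
From mathcomp Require Import all_boot.
From mathcomp Require Import boolp classical_sets.

Set Implicit Arguments.
Unset Strict Implicit.
Unset Printing Implicit Defensive.

Local Open Scope group_scope.
Local Open Scope classical_set_scope.

Section EDenseSemigroup.
Context {S : semigroupType}.
Implicit Types (s t : S) (A H : set S).

Definition idempotents : set S := [set e | e * e = e].

Definition weak_inverses s : set S := [set s' | s' * s * s' = s'].

Definition subsemigroup A : Prop :=
  A !=set0 /\ (forall a b, A a -> A b -> A (a * b)).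

Definition order_le s t : Prop :=
  s = t \/ exists e f, [/\ idempotents e, idempotents f, s = t * e & s = f * t].

Definition omega A : set S := [set s | exists2 a, A a & order_le a s].

Definition omega_closed A : Prop := A = omega A.

(* The weak inverses of h are taken in S, not in H. *)
Definition E_dense_subsemigroup H : Prop :=
  subsemigroup H /\ (forall h, H h -> (weak_inverses h `&` H) !=set0).

Definition coset_domain H : set S :=
  [set s | exists2 s', weak_inverses s s' & H (s' * s)].

Definition translate_omega s A : set S := omega [set s * a | a in A].

Definition left_cosets H : set (set S) :=
  [set translate_omega s H | s in coset_domain H].

(* [insub] makes the product s . X equal to [Some] of (sX)omega when the latter
   is itself a left coset of H, and undefined ([None]) otherwise. *)
Definition coset_act H (s : S) (X : set_type (left_cosets H)) :
    option (set_type (left_cosets H)) :=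
  insub (translate_omega s (val X)).

End EDenseSemigroup.

Definition idempotents_semilattice (S : semigroupType) : Prop :=
  subsemigroup (@idempotents S) /\
  (forall e f : S, idempotents e -> idempotents f -> e * f = f * e).

Definition E_dense (S : semigroupType) : Prop :=
  forall s : S, exists t u : S, idempotents (t * s) /\ idempotents (s * u).

(* A partial map S x X -> X is a function into [option X]; "sx exists" is
   [isSome (act s x)], silently inserted as a coercion. *)
Section Acts.
Context {S : semigroupType} {X : Type}.
Implicit Type act : S -> X -> option X.

Record E_dense_act act : Prop := {
  act_nonempty : inhabited X;
  act_exists_mul : forall s t x,
    act (s * t) x <-> exists2 y, act t x = Some y & act s y;
  act_mul : forall s t x y, act (s * t) x -> act t x = Some y ->
    act (s * t) x = act s y;
  act_cancellative : forall s x y z,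
    act s x = Some z -> act s y = Some z -> x = y;
  act_reflexive : forall s x y, act s x = Some y ->
    exists2 s', weak_inverses s s' & act s' y }.

Definition act_transitive act : Prop :=
  forall x y, exists s, act s x = Some y.

Definition stabilizer act (x : X) : set S := [set s | act s x = Some x].

End Acts.

(* Main.v *)
Require Import Defs.
From mathcomp Require Import all_boot.
From mathcomp Require Import boolp classical_sets.

(** Everything rests on a linear description of cosets.  If s' is a weak inverse
    of s with s's in H, then

      x lies in (sH)omega   if and only if   s'x lies in H

    ([mem_coset]), so questions about the closure operator become questions
    about membership in H.  These are settled by three absorption properties of
    a closed E-dense subsemigroup: an idempotent factor may be cancelled on the
    left, on the right, or in the middle of a product known to be in H
    ([cancel_idempotentl], [cancel_idempotentr], [cancel_idempotent_mid]).  In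
    particular H is left and right unitary ([unitaryl], [unitaryr]).

    It follows that the cosets partition the domain D_H: a coset is determined
    by any one of its points ([coset_point]).  The action can therefore be read
    off on points: if X and Y are cosets and x is in X, then s.X is defined and
    equal to Y exactly when sx is in Y ([coset_actE]).  Hence the act s.X is
    modelled on left multiplication in S, and the act axioms reduce to the
    observation that a weak inverse w of sx yields the weak inverses ws of x and
    xw of s.  Transitivity is witnessed by the element y x', where x'x is in H,
    which carries x to a point of yH; and H is itself a coset, whose stabilizer
    is H by right unitarity. *)

Set Implicit Arguments.
Unset Strict Implicit.
Unset Printing Implicit Defensive.

Local Open Scope group_scope.
Local Open Scope classical_set_scope.

(** * Weak inverses and idempotents *)

Section WeakInverses.
Context {S : semigroupType}.
Implicit Types s t u z e : S.

Lemma weak_inverse_mull s z : weak_inverses s z -> idempotents (z * s).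
Proof. by rewrite /idempotents /weak_inverses /= => zP; rewrite mulgA zP. Qed.

Lemma weak_inverse_mulr s z : weak_inverses s z -> idempotents (s * z).
Proof.
by rewrite /idempotents /weak_inverses /= => zP; rewrite -mulgA [z * _]mulgA zP.
Qed.

(** This and the next lemma come from multiplying w(st)w = w by s on the right,
    respectively by t on the left. *)
Lemma weak_inverse_factorr s t w : weak_inverses (s * t) w ->
  weak_inverses t (w * s).
Proof.
by rewrite /weak_inverses /= => /(congr1 (fun u => u * s)); rewrite !mulgA.
Qed.

Lemma weak_inverse_factorl s t w : weak_inverses (s * t) w ->
  weak_inverses s (t * w).
Proof.
by rewrite /weak_inverses /= => /(congr1 (fun u => t * u)); rewrite !mulgA.
Qed.

Lemma order_le_refl s : order_le s s. Proof. by left. Qed.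

Context (semilatS : idempotents_semilattice S).

Lemma idempotentM e f : idempotents e -> idempotents f -> idempotents (e * f).
Proof. by move: semilatS => [[_ clE] _]; exact: clE. Qed.

Lemma idempotentC e f : idempotents e -> idempotents f -> e * f = f * e.
Proof. by move: semilatS => [_]; exact. Qed.

(** In general es is not below s, since it need not be of the form sf.  The extra
    factor zs repairs this: esz = sze turns e(szs) into s(zes). *)
Lemma order_le_mull s z e : weak_inverses s z -> idempotents e ->
  order_le (e * s * (z * s)) s.
Proof.
move=> zP eP; have szP := weak_inverse_mulr zP.
have esz : e * s * (z * s) = e * (s * z) * s by rewrite !mulgA.
right; exists (z * e * s), (e * (s * z)); split=> //.
- have : z * e * s * (z * e * s) = z * (e * (s * z) * e) * s by rewrite !mulgA.
  rewrite /idempotents /= => ->.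
  rewrite (idempotentC eP szP) -(mulgA (s * z)) eP.
  by rewrite !mulgA (zP : z * s * z = z).
- exact: idempotentM.
- by rewrite esz (idempotentC eP szP) !mulgA.
Qed.

Lemma order_le_mulr s z e : weak_inverses s z -> idempotents e ->
  order_le (s * z * (s * e)) s.
Proof.
move=> zP eP; have zsP := weak_inverse_mull zP.
have sze : s * z * (s * e) = s * (z * s * e) by rewrite !mulgA.
right; exists (z * s * e), (s * e * z); split=> //.
- exact: idempotentM.
- have : s * e * z * (s * e * z) = s * (e * (z * s) * e) * z by rewrite !mulgA.
  rewrite /idempotents /= => ->.
  rewrite -(mulgA e) (idempotentC zsP eP) (mulgA e e) eP.
  by rewrite -!mulgA (mulgA z) (zP : z * s * z = z).
- by rewrite sze (idempotentC zsP eP) !mulgA.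
Qed.

End WeakInverses.

(** * Absorption properties of a closed E-dense subsemigroup *)

Section ClosedSubsemigroup.
Context {S : semigroupType} {H : set S}.
Implicit Types (s t u x y z e : S) (A B : set S).
Context (semilatS : idempotents_semilattice S).
Context (denseH : E_dense_subsemigroup H).
Context (closedH : omega_closed H).

Lemma subM x y : H x -> H y -> H (x * y).
Proof. by move: denseH => [[_ clH] _]; exact: clH. Qed.

Lemma sub_weak_inverse h : H h -> exists2 h', weak_inverses h h' & H h'.
Proof. by move: denseH => [_ dH] /dH [h' []]; exists h'. Qed.

Lemma sub_up x y : H x -> order_le x y -> H y.
Proof. by move=> Hx xy; rewrite closedH; exists x. Qed.

(** If y in H is a weak inverse of es, then ye is a weak inverse of s and
    es(yes) is an element of H below s. *)
Lemma cancel_idempotentl e s : idempotents e -> H (e * s) -> H s.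
Proof.
move=> eP Hes; have [y yP Hy] := sub_weak_inverse Hes.
apply: sub_up (order_le_mull semilatS (weak_inverse_factorr yP) eP).
by apply: subM => //; rewrite -mulgA; exact: subM.
Qed.

Lemma cancel_idempotentr e s : idempotents e -> H (s * e) -> H s.
Proof.
move=> eP Hse; have [y yP Hy] := sub_weak_inverse Hse.
apply: sub_up (order_le_mulr semilatS (weak_inverse_factorl yP) eP).
by apply: subM => //; rewrite mulgA; exact: subM.
Qed.

Lemma unitaryl h s : H h -> H (h * s) -> H s.
Proof.
move=> Hh Hhs; have [h' h'P Hh'] := sub_weak_inverse Hh.
apply: (cancel_idempotentl (weak_inverse_mull h'P)).
by rewrite -mulgA; exact: subM.
Qed.

Lemma unitaryr h s : H h -> H (s * h) -> H s.
Proof.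
move=> Hh Hsh; have [h' h'P Hh'] := sub_weak_inverse Hh.
apply: (cancel_idempotentr (weak_inverse_mulr h'P)).
by rewrite mulgA; exact: subM.
Qed.

(** If y in H is a weak inverse of aex, then a' = exy is a weak inverse of a for
    which aa' is in H.  So H contains aa'(aex), which equals (aea')(ax), and aea'
    can be cancelled because it is idempotent. *)
Lemma cancel_idempotent_mid e a x : idempotents e -> H (a * e * x) -> H (a * x).
Proof.
move=> eP Haex; have [y yP Hy] := sub_weak_inverse Haex.
have [a' a'P Haa'] : exists2 a', weak_inverses a a' & H (a * a').
  exists (e * x * y); first by apply: weak_inverse_factorl; rewrite mulgA.
  by rewrite !mulgA; exact: subM.
have a'aP := weak_inverse_mull a'P.
have swap : a * a' * (a * e * x) = a * e * a' * (a * x).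
  have -> : a * a' * (a * e * x) = a * (a' * a * e) * x by rewrite !mulgA.
  by rewrite (idempotentC semilatS a'aP eP) !mulgA.
apply: (@cancel_idempotentl (a * e * a')); last by rewrite -swap; exact: subM.
have : a * e * a' * (a * e * a') = a * (e * (a' * a) * e) * a'.
  by rewrite !mulgA.
rewrite /idempotents /= => ->.
rewrite -(mulgA e) (idempotentC semilatS a'aP eP) (mulgA e e) eP.
by rewrite -!mulgA (mulgA a') (a'P : a' * a * a' = a').
Qed.

(** * Left cosets *)

(** For the converse direction, put h = s'x and let h* in H be a weak inverse of
    h.  Then h*s' is a weak inverse of x, so the element s(s'x)(h*s'x) of sH is
    below x. *)
Lemma mem_coset s s' : weak_inverses s s' -> H (s' * s) ->
  forall x, translate_omega s H x <-> H (s' * x).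
Proof.
move=> s'P Hs's x; split=> [[_ [h Hh <-] shx]|Hs'x].
  have Hs'sh : H (s' * (s * h)) by rewrite mulgA; exact: subM.
  case: shx => [<- //|[e [f [eP _ xe _]]]].
  by apply: (cancel_idempotentr eP); rewrite -mulgA -xe.
have [h' h'P Hh'] := sub_weak_inverse Hs'x.
exists (s * (s' * x * (h' * s' * x))).
  exists (s' * x * (h' * s' * x)) => //.
  by apply: subM => //; rewrite -mulgA; exact: subM.
have -> : s * (s' * x * (h' * s' * x)) = s * s' * x * (h' * s' * x).
  by rewrite !mulgA.
apply: (order_le_mull semilatS (e := s * s')) => //.
- exact: weak_inverse_factorr.
- exact: weak_inverse_mulr.
Qed.

Lemma coset_self s : coset_domain H s -> translate_omega s H s.
Proof. by move=> [s' s'P Hs's]; apply/(mem_coset s'P Hs's). Qed.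

Lemma left_cosetP s : coset_domain H s -> left_cosets H (translate_omega s H).
Proof. by move=> sD; exists s. Qed.

Lemma coset_nonempty A : left_cosets H A -> A !=set0.
Proof. by move=> [s sD <-]; exists s; exact: coset_self. Qed.

Lemma coset_point A x : left_cosets H A -> A x ->
  coset_domain H x /\ A = translate_omega x H.
Proof.
move=> [s [s' s'P Hs's] <-] /(mem_coset s'P Hs's) Hs'x.
have [h' h'P Hh'] := sub_weak_inverse Hs'x.
have wP := weak_inverse_factorr h'P.
have Hw : H (h' * s' * x) by rewrite -mulgA; exact: subM.
split; first by exists (h' * s').
apply/seteqP; split=> y.
  move=> /(mem_coset s'P Hs's) Hs'y; apply/(mem_coset wP Hw).
  by rewrite -mulgA; exact: subM.
move=> /(mem_coset wP Hw); rewrite -mulgA => Hy; apply/(mem_coset s'P Hs's).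
exact: unitaryl Hh' Hy.
Qed.

Lemma coset_mulr A x h : left_cosets H A -> A x -> H h -> A (x * h).
Proof.
move=> Ac Ax Hh; have [_ ->] := coset_point Ac Ax.
by exists (x * h); [exists h | exact: order_le_refl].
Qed.

Lemma coset_up A x y : left_cosets H A -> A x -> order_le x y -> A y.
Proof.
move=> [s [s' s'P Hs's] <-] /(mem_coset s'P Hs's) Hs'x xy.
apply/(mem_coset s'P Hs's); case: xy => [<- //|[e [_ [eP _ xE _]]]].
by apply: (cancel_idempotentr eP); rewrite -mulgA -xE.
Qed.

Lemma coset_domain_factorr s t : coset_domain H (s * t) -> coset_domain H t.
Proof.
move=> [w wP Hw]; exists (w * s); last by rewrite -mulgA.
exact: weak_inverse_factorr.
Qed.

(** Let x' and w be weak inverses of x and sx with x'x and wsx in H.  For y in A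
    the product (wsx)(x'y) = ws(xx')y is in H, and cancelling the idempotent xx'
    gives wsy in H, the condition for sy to lie in B. *)
Lemma coset_mull A B s x y : left_cosets H A -> left_cosets H B ->
  A x -> B (s * x) -> A y -> B (s * y).
Proof.
move=> Ac Bc Ax Bsx Ay.
have [[x' x'P Hx'x] AE] := coset_point Ac Ax.
have [[w wP Hw] ->] := coset_point Bc Bsx.
move: Ay; rewrite AE => /(mem_coset x'P Hx'x) Hx'y.
apply/(mem_coset wP Hw); rewrite mulgA.
apply: (cancel_idempotent_mid (weak_inverse_mulr x'P)).
by have := subM Hw Hx'y; rewrite !mulgA.
Qed.

(** With w as in [coset_mull], wsy is in H, and ws is a weak inverse of x with
    (ws)x in H, so that y lies in the coset of x. *)
Lemma coset_cancel A B s x y : left_cosets H A -> left_cosets H B ->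
  A x -> B (s * x) -> B (s * y) -> A y.
Proof.
move=> Ac Bc Ax Bsx; have [_ ->] := coset_point Ac Ax.
have [[w wP Hw] ->] := coset_point Bc Bsx.
move=> /(mem_coset wP Hw) Hwsy.
have Hwsx : H (w * s * x) by rewrite -mulgA.
by apply/(mem_coset (weak_inverse_factorr wP) Hwsx); rewrite -mulgA.
Qed.

Lemma translate_coset A B s x : left_cosets H A -> left_cosets H B -> A x ->
  translate_omega s A = B <-> B (s * x).
Proof.
move=> Ac Bc Ax; split=> [<-|Bsx].
  by exists (s * x); [exists x | exact: order_le_refl].
apply/seteqP; split=> [y [_ [a Aa <-] le_y]|y].
  exact: coset_up Bc (coset_mull Ac Bc Ax Bsx Aa) le_y.
have [_ ->] := coset_point Bc Bsx => -[_ [h Hh <-] le_y].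
exists (s * x * h) => //; exists (x * h); last by rewrite mulgA.
exact: coset_mulr.
Qed.

(** For h' in H a weak inverse of h, the coset of h consists of the x such that
    h'x is in H, which is H by left unitarity. *)
Lemma left_coset_sub : left_cosets H H.
Proof.
move: denseH => [[[h Hh] _] _]; have [h' h'P Hh'] := sub_weak_inverse Hh.
have Hh'h := subM Hh' Hh; exists h; first by exists h'.
apply/seteqP; split=> x; first by move=> /(mem_coset h'P Hh'h); exact: unitaryl.
by move=> Hx; apply/(mem_coset h'P Hh'h); exact: subM.
Qed.

(** * The action on left cosets *)

Implicit Types X Y Z : set_type (left_cosets H).

Lemma cosetP X : left_cosets H (val X).
Proof. exact: set_valP. Qed.

Lemma coset_actE X Y s x : val X x -> coset_act s X = Some Y <-> val Y (s * x).
Proof.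
move=> Xx; rewrite -(translate_coset s (cosetP X) (cosetP Y) Xx) /coset_act.
split=> [|->]; last exact: valK.
by case: insubP => // Y' _ <- [->].
Qed.

Lemma coset_of_point x : coset_domain H x -> exists X, val X x.
Proof.
move=> xD; exists (SigSub (mem_set (left_cosetP xD))).
exact: coset_self.
Qed.

Lemma coset_act_defined X s x : val X x ->
  coset_act s X <-> coset_domain H (s * x).
Proof.
move=> Xx; split=> [|sxD].
  case E: (coset_act s X) => [Y|] // _; move/(coset_actE _ _ Xx): E => Ysx.
  by have [] := coset_point (cosetP Y) Ysx.
by have [Y /(coset_actE _ _ Xx) ->] := coset_of_point sxD.
Qed.

Lemma coset_E_dense_act : E_dense_act (@coset_act S H).
Proof.
split.
- exact: inhabits (SigSub (mem_set left_coset_sub)).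
- move=> s t X; have [x Xx] := coset_nonempty (cosetP X).
  rewrite (coset_act_defined _ Xx) -mulgA; split=> [stxD|[Y]].
    have [Y Ytx] := coset_of_point (coset_domain_factorr stxD).
    exists Y; first exact/(coset_actE _ _ Xx).
    exact/(coset_act_defined _ Ytx).
  by move=> /(coset_actE _ _ Xx) Ytx /(coset_act_defined _ Ytx).
- move=> s t X Y; have [x Xx] := coset_nonempty (cosetP X).
  case E: (coset_act (s * t) X) => [Z|] // _ /(coset_actE _ _ Xx) Ytx.
  move/(coset_actE _ _ Xx): E; rewrite -mulgA => Zstx.
  exact/esym/(coset_actE _ _ Ytx).
- move=> s X Y Z; have [x Xx] := coset_nonempty (cosetP X).
  have [y Yy] := coset_nonempty (cosetP Y).
  move=> /(coset_actE _ _ Xx) Zsx /(coset_actE _ _ Yy) Zsy.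
  have Xy := coset_cancel (cosetP X) (cosetP Z) Xx Zsx Zsy.
  apply: val_inj; have [_ ->] := coset_point (cosetP X) Xy.
  by have [_ ->] := coset_point (cosetP Y) Yy.
- move=> s X Y; have [x Xx] := coset_nonempty (cosetP X).
  move=> /(coset_actE _ _ Xx) Ysx.
  have [[w wP Hw] _] := coset_point (cosetP Y) Ysx.
  exists (x * w); first exact: weak_inverse_factorl.
  (* (xw)(sx) = x(wsx) is in xH, hence in X. *)
  suff /(coset_actE _ _ Ysx) -> : val X (x * w * (s * x)) by [].
  by rewrite -mulgA; exact: coset_mulr (cosetP X) Xx Hw.
Qed.

Lemma coset_act_transitive : act_transitive (@coset_act S H).
Proof.
move=> X Y; have [x Xx] := coset_nonempty (cosetP X).
have [y Yy] := coset_nonempty (cosetP Y).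
have [[x' _ Hx'x] _] := coset_point (cosetP X) Xx.
exists (y * x'); apply/(coset_actE _ _ Xx); rewrite -mulgA.
exact: coset_mulr (cosetP Y) Yy Hx'x.
Qed.

Lemma coset_stabilizer X : val X = H -> stabilizer (@coset_act S H) X = H.
Proof.
move=> XE; have [[[h Hh] _] _] := denseH.
have Xh : val X h by rewrite XE.
apply/seteqP; split=> s; rewrite /stabilizer /=.
  by move=> /(coset_actE _ _ Xh); rewrite XE; exact: unitaryr.
by move=> Hs; apply/(coset_actE _ _ Xh); rewrite XE; exact: subM.
Qed.

End ClosedSubsemigroup.

Theorem theorem2p21 (S : semigroupType) (H : set S) :
  E_dense S ->
  idempotents_semilattice S ->
  E_dense_subsemigroup H ->
  omega_closed H ->
  [/\ E_dense_act (@coset_act S H),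
      act_transitive (@coset_act S H) &
      exists X : set_type (left_cosets H),
        [/\ val X = omega H, omega H = H &
            stabilizer (@coset_act S H) X = H]].
Proof.
move=> _ semilatS denseH closedH; split.
- exact: coset_E_dense_act.
- exact: coset_act_transitive.
- exists (SigSub (mem_set (left_coset_sub semilatS denseH closedH))).
  by split; [exact: closedH | exact/esym | exact: coset_stabilizer].
Qed.
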